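(* Let $K\in C^2(\mathbb{T}^d\times\mathbb{T}^d)$ be real-valued and translation invariant, i.e. $K(x,y)=\eta(x-y)$ for $x,y\in\mathbb{T}^d$, where $\eta$ is a periodic function (a function on $\mathbb{T}^d$). Then all partial Fourier sums of $K$ and their (real) linear combinations, such as $K_{rr}$ and $\Sigma_{rr}$ for $r\in\mathbb{N}_0^d$, contain only the expansion terms $$\cos(2\pi\alpha\cdot x)\cos(2\pi\alpha\cdot y),\quad \cos(2\pi\alpha\cdot x)\sin(2\pi\alpha\cdot y),\quad \sin(2\pi\alpha\cdot x)\cos(2\pi\alpha\cdot y),\quad \sin(2\pi\alpha\cdot x)\sin(2\pi\alpha\cdot y),$$ with the same frequency $\alpha\in\mathbb{Z}^d$ in $x$ and in $y$. Therefore, the coefficient matrices of such approximations with respect to the trigonometric basis are block-diagonal, consisting of $2\times2$ blocks (one for each frequency $\alpha$) that are scalar multiples of $$\Delta_\alpha=\begin{pmatrix}\int_{\mathbb{T}^d}\eta(y)\cos(2\pi\alpha\cdot y)\,dy & \int_{\mathbb{T}^d}\eta(y)\sin(2\pi\alpha\cdot y)\,dy\\ -\int_{\mathbb{T}^d}\eta(y)\sin(2\pi\alpha\cdot y)\,dy & \int_{\mathbb{T}^d}\eta(y)\cos(2\pi\alpha\cdot y)\,dy\end{pmatrix}.$$ If, additionally, $K$ is symmetric, i.e. $K(x,y)=K(y,x)$ for all $x,y\in\mathbb{T}^d$, then these coefficient matrices are diagonal.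
   Context: $\mathbb{T}^d$ is the $d$-dimensional flat torus (period $1$ in each coordinate). For $\alpha,\beta\in\mathbb{Z}^d$ set $\hat K_{\alpha\beta}=\int_{\mathbb{T}^d\times\mathbb{T}^d}K(x,y)e^{-2i\pi(\alpha\cdot x+\beta\cdot y)}\,dx\,dy$. A partial Fourier sum of $K$ is a sum $\sum_{(\alpha,\beta)\in\Lambda}\hat K_{\alpha\beta}e^{2i\pi(\alpha\cdot x+\beta\cdot y)}$ over a finite set $\Lambda\subset\mathbb{Z}^d\times\mathbb{Z}^d$ with $-\Lambda=\Lambda$ (so that the sum is real-valued). In particular, for $r_1,r_2\in\mathbb{N}_0^d$ the rectangular partial Fourier sum is $K_{r_1r_2}(x,y)=\sum_{|\alpha|\le r_1,|\beta|\le r_2}\hat K_{\alpha\beta}e^{2i\pi(\alpha\cdot x+\beta\cdot y)}$, where $|\alpha|=(|\alpha_1|,\dots,|\alpha_d|)$ and inequalities are componentwise, and the rectangular Fejér average is $\Sigma_{r_1r_2}=\frac{1}{\prod_{j=1}^d(1+r_{1j})(1+r_{2j})}\sum_{0\le s_1\le r_1,\,0\le s_2\le r_2}K_{s_1s_2}$ (sum over $s_1,s_2\in\mathbb{N}_0^d$); $K_{rr}$ and $\Sigma_{rr}$ correspond to $r_1=r_2=r$. The trigonometric basis consists of the functions $\sin(2\pi\alpha\cdot x),\cos(2\pi\alpha\cdot x)$, with one representative $\alpha$ chosen from each pair $\{\alpha,-\alpha\}$, $\alpha\ne0$, together with the constant function $1$ (for $\alpha=0$ the block reduces to the single entry corresponding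 to the constant function, a multiple of $\int_{\mathbb{T}^d}\eta$). The coefficient matrix of a kernel $\sum_{i,j}k_{ij}\phi_i(x)\phi_j(y)$ with respect to basis functions $\{\phi_i\}$ is $(k_{ij})$; within the block of frequency $\alpha$ the basis functions are ordered as $(\sin(2\pi\alpha\cdot x),\cos(2\pi\alpha\cdot x))$. *)

(* Defs.v *)
From HB Require Import structures.
From mathcomp Require Import all_boot all_order all_algebra.
From mathcomp Require Import complex.
From mathcomp Require Import all_classical all_reals all_analysis.

Set Implicit Arguments.
Unset Strict Implicit.
Unset Printing Implicit Defensive.

Import Order.TTheory GRing.Theory Num.Theory.
Import numFieldNormedType.Exports.

Local Open Scope classical_set_scope.
Local Open Scope ring_scope.

(* The torus T^d is R^d / Z^d: functions on T^d are the functions on 'rV[R]_d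
   that are invariant under integer translations. *)
Definition torus_periodic (R : realType) (d : nat) (T : Type)
    (f : 'rV[R]_d -> T) :=
  forall (x : 'rV[R]_d) (m : 'rV[int]_d), f (x + map_mx intr m) = f x.

Fixpoint Ck (R : realType) (V : normedModType R) (n : nat) (f : V -> R) : Prop :=
  if n is n'.+1 then
    (forall x, differentiable f x) /\ (forall v, Ck n' ('D_v f))
  else continuous f.

Section TorusMeasure.
Variable R : realType.

Definition cons_pair (n : nat)
    (p : measurableTypeR R * n.-tuple (measurableTypeR R)) :
  n.+1.-tuple (measurableTypeR R) := [tuple of p.1 :: p.2].

Lemma measurable_cons_pair n : measurable_fun setT (@cons_pair n).
Proof.
apply: (@measurable_cons _ _ _ _ fst n snd).
- exact: measurable_fst.
- exact: measurable_snd.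
Qed.

HB.instance Definition _ n :=
  isMeasurableFun.Build _ _ _ _ (@cons_pair n) (@measurable_cons_pair n).

(* Lebesgue measure on T^d, carried by the fundamental domain [0, 1]^d: the
   d-fold product of the Lebesgue measure restricted to [0, 1], which is
   [uniform_prob ltr01]. *)
Fixpoint torus (d : nat) : probability (d.-tuple (measurableTypeR R)) R :=
  if d is d'.+1 then
    distribution (uniform_prob (@ltr01 R) \x torus d')%E (@cons_pair d')
  else dirac [tuple].

Definition row_of d (t : d.-tuple (measurableTypeR R)) : 'rV[R]_d :=
  \row_(j < d) tnth t j.

Definition torus_int d (f : 'rV[R]_d -> R) : R :=
  \int[torus d]_t f (row_of t).

Definition torus_int2 d (f : 'rV[R]_d -> 'rV[R]_d -> R) : R :=
  \int[(torus d \x torus d)%E]_p f (row_of p.1) (row_of p.2).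

Definition torus_int2C d (f : 'rV[R]_d -> 'rV[R]_d -> R[i]) : R[i] :=
  Complex (torus_int2 (fun x y => complex.Re (f x y)))
          (torus_int2 (fun x y => complex.Im (f x y))).

End TorusMeasure.

Section Fourier.
Variables (R : realType) (d : nat).
Local Notation rV := 'rV[R]_d.
Local Notation freq := 'rV[int]_d.

Definition dot (alpha : freq) (x : rV) : R :=
  \sum_(j < d) (alpha 0 j)%:~R * x 0 j.

Definition expi (t : R) : R[i] := Complex (cos t) (sin t).

Definition fourier_coef (K : rV -> rV -> R) (alpha beta : freq) : R[i] :=
  torus_int2C (fun x y => (K x y)%:C%C *
    expi (- (2 * pi * (dot alpha x + dot beta y)))).

Definition symmetric_freqs (L : set (freq * freq)) : Prop :=
  finite_set L /\ (forall p, L p -> L (- p)).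

Definition fourier_sum (K : rV -> rV -> R) (L : set (freq * freq)) (x y : rV) :
    R[i] :=
  \sum_(p \in L) fourier_coef K p.1 p.2 *
    expi (2 * pi * (dot p.1 x + dot p.2 y)).

Definition rect_freqs (r1 r2 : 'rV[nat]_d) : set (freq * freq) :=
  [set p : freq * freq | (forall j, (`|p.1 ord0 j| <= r1 ord0 j)%N) /\
           (forall j, (`|p.2 ord0 j| <= r2 ord0 j)%N)].

Definition rect_sum (K : rV -> rV -> R) (r1 r2 : 'rV[nat]_d) : rV -> rV -> R[i] :=
  fourier_sum K (rect_freqs r1 r2).

Definition fejer_average (K : rV -> rV -> R) (r1 r2 : 'rV[nat]_d) (x y : rV) :
    R[i] :=
  (\prod_(j < d) ((1 + r1 ord0 j)%N%:R * (1 + r2 ord0 j)%N%:R))^-1 *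
  \sum_(s \in [set s : 'rV[nat]_d * 'rV[nat]_d |
                (forall j, (s.1 ord0 j <= r1 ord0 j)%N) /\
                (forall j, (s.2 ord0 j <= r2 ord0 j)%N)])
    rect_sum K s.1 s.2 x y.

Definition real_lincomb_fourier_sums (K : rV -> rV -> R)
    (F : rV -> rV -> R[i]) : Prop :=
  exists (n : nat) (c : 'I_n -> R) (L : 'I_n -> set (freq * freq)),
    (forall i, symmetric_freqs (L i)) /\
    (forall x y, F x y = \sum_(i < n) (c i)%:C%C * fourier_sum K (L i) x y).

Definition cosf (alpha : freq) (x : rV) : R := cos (2 * pi * dot alpha x).
Definition sinf (alpha : freq) (x : rV) : R := sin (2 * pi * dot alpha x).

(* The sums are computed in R[i]; being equal to a real expansion, F is in
   particular real-valued. *)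
Definition same_frequency_terms (F : rV -> rV -> R[i]) : Prop :=
  exists (A : set freq) (a b c e : freq -> R), finite_set A /\
    forall x y, F x y =
      (\sum_(alpha \in A) (a alpha * (cosf alpha x * cosf alpha y)
                         + b alpha * (cosf alpha x * sinf alpha y)
                         + c alpha * (sinf alpha x * cosf alpha y)
                         + e alpha * (sinf alpha x * sinf alpha y)))%:C%C.

Definition representatives (H : set freq) : Prop :=
  ~ H 0 /\ (forall alpha : freq, alpha != 0 -> (H alpha <-> ~ H (- alpha))).

(* Basis functions are indexed by pairs of a frequency and an element of 'I_2:
   0 for the sine, 1 for the cosine; the constant function 1 is the cosine of
   frequency 0. *)
Definition trig_index := (freq * 'I_2)%type.

Definition trig_basis (H : set freq) : set trig_index :=
  [set i | H i.1 \/ i = (0, 1)].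

Definition trig (i : trig_index) (x : rV) : R :=
  if i.2 == 0 then sinf i.1 x else cosf i.1 x.

(* A matrix indexed by the basis is extended by 0 to all of trig_index. *)
Definition coefficient_matrix (H : set freq) (k : trig_index -> trig_index -> R)
    (F : rV -> rV -> R[i]) : Prop :=
  [/\ finite_set [set p | k p.1 p.2 != 0],
      forall i j, k i j != 0 -> trig_basis H i /\ trig_basis H j
    & forall x y, F x y =
        (\sum_(p \in trig_basis H `*` trig_basis H)
           k p.1 p.2 * (trig p.1 x * trig p.2 y))%:C%C].

Definition freq_block (k : trig_index -> trig_index -> R) (alpha : freq) : 'M[R]_2 :=
  \matrix_(i < 2, j < 2) k (alpha, i) (alpha, j).

Definition block_diagonal_coefs (k : trig_index -> trig_index -> R) : Prop :=
  forall alpha beta i j, alpha != beta -> k (alpha, i) (beta, j) = 0.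

Definition diagonal_coefs (k : trig_index -> trig_index -> R) : Prop :=
  forall i j, i != j -> k i j = 0.

Definition Delta (eta : rV -> R) (alpha : freq) : 'M[R]_2 :=
  let C := torus_int (fun y => eta y * cosf alpha y) in
  let S := torus_int (fun y => eta y * sinf alpha y) in
  \matrix_(i < 2, j < 2)
    if i == j then C else if i == 0 then S else - S.

End Fourier.

(* Main.v *)
Require Import Defs.
From HB Require Import structures.
From mathcomp Require Import all_boot all_order all_algebra.
From mathcomp Require Import complex.
From mathcomp Require Import all_classical all_reals all_analysis.
From mathcomp Require Import finmap measurable_realfun ring lra.
Import Order.TTheory GRing.Theory Num.Theory.
Import numFieldNormedType.Exports.
Local Open Scope classical_set_scope.
Local Open Scope ring_scope.

Set Implicit Arguments.
Unset Strict Implicit.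
Unset Printing Implicit Defensive.

(** For K(x, y) = eta(x - y) the whole statement follows from one computation:
    the Fourier coefficient of K at (alpha, beta) vanishes unless
    alpha + beta = 0, and at (alpha, - alpha) it equals C - i S, where C and S
    are the integrals of eta against cos(2 pi alpha.y) and sin(2 pi alpha.y)
    ([fourier_coef_conv]).  By Fubini the coefficient is an iterated integral;
    translating x by y turns the integrand into eta(x) times a trigonometric
    function of alpha.x + (alpha + beta).y, so that integrating over x produces
    C and S and integrating over y kills every nonzero frequency alpha + beta.

    The analytic input is the translation invariance of integration over the
    torus ([torus_int_shift]), which is proved one coordinate at a time: in one
    variable, a period of a periodic function can be cut at any point and
    reassembled ([ge0_integral_period]); in several variables, Tonelli
    separates the first coordinate from the others.  Invariance also yields the
    orthogonality of characters without any primitive: translation by half a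
    period changes the sign of cos(2 pi alpha.x) and of sin(2 pi alpha.x).

    Pairing alpha with - alpha in a symmetric frequency set makes the imaginary
    parts cancel, so every real linear combination of partial sums has the form
    sum_alpha n(alpha) (C cos(2 pi alpha.(x - y)) + S sin(2 pi alpha.(x - y)))
    with n even and finitely supported ([lincomb_canonical]).  The addition
    formulas then display the four products of equal frequency, and merging
    alpha with - alpha gives the coefficient matrix whose block at alpha is
    2 n(alpha) Delta_alpha ([coefficient_matrix_block]).  The trigonometric
    basis is orthogonal in each variable, so an expansion determines its
    coefficients ([coefficient_matrix_unique]) and every coefficient matrix is
    that one.

    If K is symmetric then eta is even, and Fubini applied to
    eta(x - y) sin(2 pi alpha.(x - y)) in both orders gives S = - S
    ([sin_coef_even]); the off-diagonal entries of Delta_alpha are S and - S. *)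

(** * Integration over one period *)

Section OnePeriod.
Context {R : realType}.
Local Notation mu := (@lebesgue_measure R).
Local Notation RM := (measurableTypeR R).

Lemma measurable_shift (a : R) : measurable_fun [set: RM] (fun x : RM => x + a : RM).
Proof. exact: measurable_funD. Qed.

Lemma shift_preimage_itv (a l r : R) (bl br : bool) :
  (fun x : R => x + a) @^-1` [set` Interval (BSide bl (l + a)) (BSide br (r + a))] =
  [set` Interval (BSide bl l) (BSide br r)].
Proof.
by case: bl; case: br; apply/seteqP; split => x /=;
  rewrite !in_itv/= ?lerD2r ?ltrD2r.
Qed.

(** Lebesgue measure is determined by its values on half-open intervals, and
    their lengths do not change under translation. *)
Lemma lebesgue_measure_shift (a : R) (A : set RM) : measurable A ->
  pushforward mu (fun x : RM => x + a : RM) A = mu A.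
Proof.
pose phi_mixin := isMeasurableFun.Build _ _ _ _ _ (measurable_shift a).
pose phi : {mfun RM >-> RM} := HB.pack (fun x : RM => x + a : RM) phi_mixin.
move=> mA; apply/esym.
apply: (@lebesgue_measure_unique R (pushforward mu phi)) => //= _ [[l r]] _ <-.
have := shift_preimage_itv a (l - a) (r - a) false false.
rewrite !subrK /pushforward /= => ->; rewrite !lebesgue_measure_itv/=.
by rewrite !lte_fin ltrD2r -!EFinB opprB addrA subrK.
Qed.

Lemma ge0_integral_shift (a l r : R) (f : R -> \bar R) :
  measurable_fun [set: R] f -> (forall x, 0 <= f x)%E ->
  (\int[mu]_(x in `[l, r[) f (x + a)%R =
   \int[mu]_(x in `[(l + a)%R, (r + a)%R[) f x)%E.
Proof.
move=> mf f0.
rewrite -(shift_preimage_itv a l r true true).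
rewrite -(@ge0_integral_pushforward _ _ RM RM R _ (measurable_shift a) mu _ f)//;
  last exact: measurable_funS mf.
apply: eq_measure_integral => [|mphi A mA _]; first exact: measurable_shift.
exact: lebesgue_measure_shift.
Qed.

(** Let b be the fractional part of a.  The shifted integral runs over
    [b, 1 + b[, which is [b, 1[ followed by a copy of [0, b[ translated by the
    period 1.  Nonnegativity spares every integrability condition, here and in
    the Tonelli step that reduces several variables to this one. *)
Lemma ge0_integral_period (a : R) (f : R -> \bar R) :
  measurable_fun [set: R] f -> (forall x, 0 <= f x)%E ->
  (forall x (m : int), f (x + m%:~R) = f x) ->
  (\int[uniform_prob (@ltr01 R)]_x f (x + a)%R =
   \int[uniform_prob (@ltr01 R)]_x f x)%E.
Proof.
move=> mf f0 fper.
have fsub (b : R) : measurable_fun [set: R] (fun x : R => f (x + b)).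
  exact: measurableT_comp (measurable_shift b).
pose b := a - (Num.floor a)%:~R.
have b0 : 0 <= b by rewrite subr_ge0 ge_floor.
have b1 : b <= 1 by rewrite lerBlDl ltW// -intrD1 floorD1_gt.
have -> : (fun x : R => f (x + a)) = (fun x => f (x + b)).
  by apply/funext => x; rewrite -(fper (x + b) (Num.floor a)) /b -addrA subrK.
rewrite (integral_uniform _ (fsub b))// (integral_uniform _ mf)//.
rewrite subr0 invr1 !mul1e.
rewrite -!integral_itv_bndo_bndc; try exact: measurable_funTS.
rewrite (ge0_integral_shift b 0 1)// add0r.
have split_itv (u v w : R) : u <= v -> v <= w ->
    (\int[mu]_(x in `[u, w[) f x =
     \int[mu]_(x in `[u, v[) f x + \int[mu]_(x in `[v, w[) f x)%E.
  move=> uv vw; rewrite (@itv_bndbnd_setU _ _ _ (BLeft v)) ?bnd_simp//.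
  rewrite ge0_integral_setU//; first exact: measurable_funTS.
  by apply/disj_setPS => x [/=]; rewrite !in_itv/= => /andP[_ ?] /andP[]; lra.
rewrite (split_itv b 1 (1 + b)) ?lerDl// (split_itv 0 b 1)// addeC.
congr (_ + _)%E.
rewrite -{1}(add0r 1) (addrC 1 b) -ge0_integral_shift//.
by apply: eq_integral => x _; exact: (fper x 1).
Qed.
End OnePeriod.

(** * Translation invariance on the torus *)

Section TorusShift.
Context {R : realType}.
Local Notation RM := (measurableTypeR R).
Local Notation tuples d := (d.-tuple (measurableTypeR R)).

Lemma measurable_tuple_map d1 (T : measurableType d1) n (f : 'I_n -> T -> RM) :
  (forall i, measurable_fun [set: T] (f i)) ->
  measurable_fun [set: T] (fun x => [tuple f i x | i < n]).
Proof.
move=> mf; apply/measurable_fun_tnthP => i.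
rewrite (_ : _ \o _ = f i)//.
by apply/funext => x /=; rewrite tnth_mktuple.
Qed.

Lemma row_of_tuple n (f : 'I_n -> R) : row_of [tuple f i | i < n] = \row_i f i.
Proof. by apply/rowP => i; rewrite !mxE tnth_mktuple. Qed.

Definition shift_tuple d (a : 'rV[R]_d) (t : tuples d) : tuples d :=
  [tuple tnth t i + a 0 i | i < d].

Lemma row_of_shift d (a : 'rV[R]_d) t : row_of (shift_tuple a t) = row_of t + a.
Proof. by rewrite row_of_tuple; apply/rowP => i; rewrite !mxE. Qed.

Lemma measurable_shift_tuple d (a : 'rV[R]_d) :
  measurable_fun [set: tuples d] (shift_tuple a).
Proof.
apply: measurable_tuple_map => i.
exact: measurableT_comp (measurable_shift _) (measurable_tnth i).
Qed.

(** The measure of the torus lives on tuples while functions are defined on row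
    vectors, so measurability is that of the function read through [row_of]. *)
Definition measurable_on_torus d d' (T : measurableType d')
    (f : 'rV[R]_d -> T) :=
  measurable_fun [set: tuples d] (fun t => f (row_of t)).

Lemma measurable_on_torus_shift d d' (T : measurableType d')
    (f : 'rV[R]_d -> T) a :
  measurable_on_torus f -> measurable_on_torus (fun x => f (x + a)).
Proof.
move=> mf; rewrite /measurable_on_torus.
rewrite (_ : (fun t => _) = (fun t => f (row_of t)) \o shift_tuple a).
  exact: measurableT_comp mf (measurable_shift_tuple a).
by apply/funext => t /=; rewrite row_of_shift.
Qed.

Definition row_cons d (u : R) (v : 'rV[R]_d) : 'rV[R]_d.+1 := row_mx u%:M v.

Lemma row_of_cons d (p : RM * tuples d) :
  row_of (cons_pair p) = row_cons p.1 (row_of p.2).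
Proof.
apply/rowP => i; rewrite !mxE; case: splitP => j ij; rewrite !mxE.
  rewrite ord1 eqxx mulr1n (_ : i = ord0) ?tnth0//.
  by apply/val_inj; rewrite /= ij ord1.
by rewrite (_ : i = lift ord0 j) ?tnthS//; apply/val_inj; rewrite /= ij.
Qed.

Lemma ge0_integral_torusS d (f : 'rV[R]_d.+1 -> \bar R) :
  measurable_on_torus f -> (forall x, 0 <= f x)%E ->
  (\int[torus R d.+1]_t f (row_of t) =
   \int[uniform_prob (@ltr01 R)]_u \int[torus R d]_t f (row_cons u (row_of t)))%E.
Proof.
move=> mf f0.
pose P := (uniform_prob (@ltr01 R) \x torus R d)%E.
transitivity (\int[P]_p f (row_of (cons_pair p)))%E.
  exact: (@ge0_integral_distribution _ _ _ _ R P (@cons_pair R d) _ mf).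
have mfc : measurable_fun setT
    (fun p : RM * tuples d => f (row_of (cons_pair p))).
  exact: measurableT_comp mf (@measurable_cons_pair R d).
rewrite [LHS](fubini_tonelli1 _ mfc (fun=> f0 _)).
by apply: eq_integral => u _; apply: eq_integral => t _ /=; rewrite row_of_cons.
Qed.

(** Induction on the dimension.  Once the first coordinate is split off by
    Tonelli, the shift of the remaining coordinates disappears by induction for
    each value of the first one, and what is left is a periodic function of a
    single variable. *)
Lemma ge0_integral_torus_shift d (f : 'rV[R]_d -> \bar R) (a : 'rV[R]_d) :
  measurable_on_torus f -> (forall x, 0 <= f x)%E -> torus_periodic f ->
  (\int[torus R d]_t f (row_of t + a)%R = \int[torus R d]_t f (row_of t))%E.
Proof.
elim: d => [|d IHd] in f a *; move=> mf f0 fper.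
  by apply: eq_integral => t _; congr f; apply/rowP => -[].
rewrite (ge0_integral_torusS mf f0).
rewrite (ge0_integral_torusS (measurable_on_torus_shift a mf) (fun=> f0 _)).
pose a0 := a 0 0; pose a' : 'rV[R]_d := rsubmx (a : 'rV[R]_(1 + d)).
have aE : a = row_cons a0 a'.
  rewrite -[LHS](@hsubmxK _ 1 1 d); congr (@row_mx _ 1 1 d _ _).
  rewrite [LHS]mx11_scalar; congr (_%:M); rewrite mxE.
  by congr (a _ _); apply/val_inj.
have row_consD u v (w z : 'rV[R]_d) :
    row_cons u w + row_cons v z = row_cons (u + v) (w + z).
  by rewrite /row_cons raddfD; exact: (@add_row_mx _ 1 1 d).
have perC (m : int) (n : 'rV[int]_d) :
    row_cons m%:~R (map_mx intr n) = map_mx intr (row_mx m%:M n) :> 'rV[R]_d.+1.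
  by rewrite map_row_mx map_scalar_mx.
pose g u := (\int[torus R d]_t f (row_cons u (row_of t)))%E.
have mfc : measurable_fun setT
    (fun p : RM * tuples d => f (row_cons p.1 (row_of p.2))).
  rewrite (_ : (fun p => _) = (fun t => f (row_of t)) \o @cons_pair R d).
    exact: measurableT_comp mf (@measurable_cons_pair R d).
  by apply/funext => p /=; rewrite row_of_cons.
have mfu u : measurable_on_torus (fun v : 'rV[R]_d => f (row_cons u v)).
  exact: measurableT_comp mfc (measurable_pair1 _).
transitivity (\int[uniform_prob (@ltr01 R)]_u g (u + a0)%R)%E.
  apply: eq_integral => u _; rewrite /g.
  rewrite -(IHd (fun v => f (row_cons (u + a0) v)) a')//.
    by apply: eq_integral => t _; rewrite {1}aE row_consD.
  move=> v m; rewrite -[u + a0]addr0 -row_consD.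
  by have := perC 0 m; rewrite mulr0z => ->; rewrite fper addr0.
apply: ge0_integral_period.
- exact: measurable_fun_fubini_tonelli_F mfc _.
- by move=> u; exact: integral_ge0.
- move=> u m; apply: eq_integral => t _; rewrite -[row_of t]addr0 -row_consD.
  have := perC m 0; rewrite map_mx0 => ->; by rewrite fper addr0.
Qed.

Lemma integral_torus_shift d (f : 'rV[R]_d -> \bar R) (a : 'rV[R]_d) :
  measurable_on_torus f -> torus_periodic f ->
  (\int[torus R d]_t f (row_of t + a)%R = \int[torus R d]_t f (row_of t))%E.
Proof.
move=> mf fper; rewrite [LHS]integralE [RHS]integralE.
have mpos : measurable_on_torus (f^\+)%E.
  rewrite /measurable_on_torus.
  rewrite (_ : (fun t => _) = (fun t : tuples d => f (row_of t))^\+)%E.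
    exact: measurable_funepos mf.
  by apply/funext => t; rewrite !funeposE.
have mneg : measurable_on_torus (f^\-)%E.
  rewrite /measurable_on_torus.
  rewrite (_ : (fun t => _) = (fun t : tuples d => f (row_of t))^\-)%E.
    exact: measurable_funeneg mf.
  by apply/funext => t; rewrite !funenegE.
have perpos : torus_periodic (f^\+)%E by move=> x m; rewrite !funeposE fper.
have perneg : torus_periodic (f^\-)%E by move=> x m; rewrite !funenegE fper.
congr (_ - _)%E.
- transitivity (\int[torus R d]_t (f^\+)%E (row_of t + a)%R)%E.
    by apply: eq_integral => t _; rewrite !funeposE.
  rewrite (ge0_integral_torus_shift a mpos (funepos_ge0 f) perpos).
  by apply: eq_integral => t _; rewrite !funeposE.
- transitivity (\int[torus R d]_t (f^\-)%E (row_of t + a)%R)%E.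
    by apply: eq_integral => t _; rewrite !funenegE.
  rewrite (ge0_integral_torus_shift a mneg (funeneg_ge0 f) perneg).
  by apply: eq_integral => t _; rewrite !funenegE.
Qed.

Lemma torus_int_shift d (f : 'rV[R]_d -> R) (a : 'rV[R]_d) :
  measurable_on_torus f -> torus_periodic f ->
  torus_int (fun x => f (x + a)) = torus_int f.
Proof.
move=> mf fper; congr fine; apply: (@integral_torus_shift d (EFin \o f)).
  exact/measurable_EFinP.
by move=> x m; rewrite /= fper.
Qed.
End TorusShift.

(** * Continuous periodic functions *)

Section ContinuousPeriodic.
Context {R : realType} {d : nat}.
Local Notation rV := 'rV[R]_d.
Local Notation RM := (measurableTypeR R).
Local Notation tuples := (d.-tuple (measurableTypeR R)).

Definition grid_floor (n : nat) (x : rV) : 'rV[int]_d :=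
  \row_i Num.floor (x 0 i * n.+1%:R).

Definition grid_point (n : nat) (z : 'rV[int]_d) : rV :=
  \row_i ((z 0 i)%:~R / n.+1%:R).

Lemma grid_point_cvg (x : rV) : grid_point n (grid_floor n x) @[n --> \oo] --> x.
Proof.
apply/cvg_ballP => e e0.
near=> n; split=> // i j; rewrite !mxE (ord1 i).
have n0 : 0 < n.+1%:R :> R by [].
have /andP[fl fu] := floor_itv (x 0 j * n.+1%:R).
have ne : n.+1%:R^-1 < e by near: n; exact: (near_infty_natSinv_lt (PosNum e0)).
rewrite /ball/= ger0_norm ?subr_ge0 ?ler_pdivrMr//.
apply: le_lt_trans ne.
rewrite lerBlDr -[X in X + _]div1r -mulrDl ler_pdivlMr// addrC.
by rewrite -[1]/(1%:~R) -intrD ltW.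
Unshelve. all: by end_near.
Qed.

(** Round each coordinate down to a multiple of 1 / (n + 1): f at the rounded
    point takes countably many values, each on a union of products of
    half-open intervals, and these functions converge to f pointwise. *)
Lemma continuous_measurable_on_torus (f : rV -> R) :
  continuous f -> measurable_on_torus f.
Proof.
move=> cf; apply: (measurable_fun_cvg
  (h := fun n t => f (grid_point n (grid_floor n (row_of t))))); last first.
  by move=> t _; apply: continuous_cvg; [exact: cf | exact: grid_point_cvg].
move=> n _ Y mY; rewrite setTI.
pose cell (z : 'rV[int]_d) :=
  [set t : tuples | Y (f (grid_point n z)) /\ grid_floor n (row_of t) = z].
rewrite (_ : _ @^-1` Y = \bigcup_z cell z); last first.
  apply/seteqP; split=> [t Yt|t [z _ [Yz zE]]]; last by rewrite /= zE.
  by exists (grid_floor n (row_of t)).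
apply: countable_bigcupT_measurable => [|z]; first exact: countableP.
have [Yz|NYz] := pselect (Y (f (grid_point n z))); last first.
  by rewrite (_ : cell z = set0)//; apply/seteqP; split=> t // [].
rewrite (_ : cell z = \bigcap_(i in [set: 'I_d])
    ((fun t : tuples => tnth t i) @^-1`
      `[(z 0 i)%:~R / n.+1%:R, (z 0 i + 1)%:~R / n.+1%:R[)); last first.
  apply/seteqP; split=> t; rewrite /cell /=.
    move=> [_ tz] i _ /=; rewrite in_itv/= ler_pdivrMr// ltr_pdivlMr//.
    by rewrite -tz !mxE floor_itv.
  move=> tz; split=> //; apply/rowP => i; rewrite !mxE; apply: floor_def.
  by have := tz i I; rewrite /= in_itv/= ler_pdivrMr// ltr_pdivlMr.
apply: fin_bigcap_measurable => // i _; rewrite -[X in measurable X]setTI.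
exact: measurable_tnth.
Qed.

(** All values are already taken on the compact box [0, 1]^d. *)
Lemma continuous_periodic_bounded (f : rV -> R) :
  continuous f -> torus_periodic f -> exists M, forall x, `|f x| <= M.
Proof.
move=> cf fper.
have cbox : compact [set v : rV | forall i, `[0, 1]%classic (v ord0 i)].
  apply: (@rV_compact R d (fun=> `[0, 1]%classic)) => i.
  exact: segment_compact.
have : bounded_set [set f x | x in
    [set v : rV | forall i, `[0, 1]%classic (v ord0 i)]].
  apply: compact_bounded; apply: continuous_compact => //.
  exact: continuous_subspaceT.
move=> [M [_ MP]]; exists (`|M| + 1) => x.
have := fper x (- (\row_i Num.floor (x 0 i))) => <-.
apply: (MP (`|M| + 1)); first by rewrite ltr_pwDr ?ler_norm.
eexists; last by [].
move=> i /=; rewrite !mxE in_itv/= rmorphN/= subr_ge0 ge_floor /=.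
by rewrite lerBlDl ltW// -intrD1 floorD1_gt.
Qed.
End ContinuousPeriodic.

(** * Integrals of continuous functions and of characters *)

Section TorusFunctions.
Context {R : realType} {d : nat}.
Local Notation rV := 'rV[R]_d.
Local Notation freq := 'rV[int]_d.
Local Notation RM := (measurableTypeR R).
Local Notation tuples := (d.-tuple (measurableTypeR R)).

Definition torus_continuous (f : rV -> R) := continuous f /\ torus_periodic f.

Lemma torus_continuous_cst (c : R) : torus_continuous (fun=> c).
Proof. by split=> [x|//]; exact: cst_continuous. Qed.

Lemma torus_continuousD f g : torus_continuous f -> torus_continuous g ->
  torus_continuous (fun x => f x + g x).
Proof.
move=> [cf pf] [cg pg]; split=> [x|x m]; last by rewrite pf pg.
exact: (cvgD (cf x) (cg x)).
Qed.

Lemma torus_continuousM f g : torus_continuous f -> torus_continuous g ->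
  torus_continuous (fun x => f x * g x).
Proof.
move=> [cf pf] [cg pg]; split=> [x|x m]; last by rewrite pf pg.
exact: (cvgM (cf x) (cg x)).
Qed.

Lemma torus_continuousZ c f :
  torus_continuous f -> torus_continuous (fun x => c * f x).
Proof. by apply: torus_continuousM; exact: torus_continuous_cst. Qed.

Lemma torus_continuous_sum (I : Type) (r : seq I) (F : I -> rV -> R) :
  (forall i, torus_continuous (F i)) ->
  torus_continuous (fun x => \sum_(i <- r) F i x).
Proof.
move=> cF; elim: r => [|i r IHr].
  under eq_fun do rewrite big_nil.
  exact: torus_continuous_cst.
under eq_fun do rewrite big_cons.
exact: torus_continuousD.
Qed.

Lemma torus_integrable f : torus_continuous f ->
  (torus R d).-integrable setT (EFin \o (fun t => f (row_of t))).
Proof.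
move=> [cf pf]; apply: measurable_bounded_integrable => //.
- by rewrite [X in (X < _)%E](@probability_setT _ _ R (torus R d)) ltry.
- exact: continuous_measurable_on_torus.
- have [M fM] := continuous_periodic_bounded cf pf.
  exists M; split; first exact: num_real.
  by move=> N MN t _ /=; exact: le_trans (ltW MN).
Qed.

Lemma torus_intD f g : torus_continuous f -> torus_continuous g ->
  torus_int (fun x => f x + g x) = torus_int f + torus_int g.
Proof. by move=> cf cg; apply: RintegralD => //; exact: torus_integrable. Qed.

Lemma torus_intZ c f : torus_continuous f ->
  torus_int (fun x => c * f x) = c * torus_int f.
Proof. by move=> cf; apply: RintegralZl => //; exact: torus_integrable. Qed.

Lemma torus_int_cst (c : R) : torus_int (fun _ : rV => c) = c.
Proof.
rewrite /torus_int Rintegral_cst//.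
by rewrite [X in fine X](@probability_setT _ _ R (torus R d)) mulr1.
Qed.

Lemma torus_int_sum (I : Type) (r : seq I) (F : I -> rV -> R) :
  (forall i, torus_continuous (F i)) ->
  torus_int (fun x => \sum_(i <- r) F i x) = \sum_(i <- r) torus_int (F i).
Proof.
move=> cF; elim: r => [|i r IHr].
  rewrite big_nil -[RHS](torus_int_cst 0); congr torus_int.
  by apply/funext => x; rewrite big_nil.
rewrite big_cons -IHr -torus_intD//; last exact: torus_continuous_sum.
by congr torus_int; apply/funext => x; rewrite big_cons.
Qed.

Lemma torus_int_translate f a :
  torus_continuous f -> torus_int (fun x => f (x + a)) = torus_int f.
Proof.
move=> [cf pf]; apply: torus_int_shift => //.
exact: continuous_measurable_on_torus.
Qed.

Lemma dotDr (a : freq) (x y : rV) : dot a (x + y) = dot a x + dot a y.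
Proof. by rewrite /dot -big_split/=; apply: eq_bigr => j _; rewrite mxE mulrDr. Qed.

Lemma dotNr (a : freq) (x : rV) : dot a (- x) = - dot a x.
Proof. by rewrite /dot -sumrN; apply: eq_bigr => j _; rewrite mxE mulrN. Qed.

Lemma dotDl (a b : freq) (x : rV) : dot (a + b) x = dot a x + dot b x.
Proof.
by rewrite /dot -big_split/=; apply: eq_bigr => j _; rewrite mxE intrD mulrDl.
Qed.

Lemma dotNl (a : freq) (x : rV) : dot (- a) x = - dot a x.
Proof.
by rewrite /dot -sumrN; apply: eq_bigr => j _; rewrite mxE rmorphN mulNr.
Qed.

Lemma dot0l (x : rV) : dot 0 x = 0.
Proof. by rewrite /dot big1// => j _; rewrite mxE mul0r. Qed.

Lemma dot_int (a m : freq) :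
  dot a (map_mx intr m) = (\sum_j a 0 j * m 0 j)%:~R :> R.
Proof. by rewrite /dot rmorph_sum/=; apply: eq_bigr => j _; rewrite mxE intrM. Qed.

Lemma dot_continuous (a : freq) : continuous (@dot R d a).
Proof.
rewrite /dot => x.
elim: (index_enum _) => [|i r IHr].
  under eq_fun do rewrite big_nil.
  exact: cst_continuous.
under eq_fun do rewrite big_cons.
exact: (cvgD (cvgM (cvg_cst _) (@coord_continuous R 1 d 0 i x)) IHr).
Qed.

Lemma periodic_2pi_int (f : R -> R) (z : int) (t : R) : periodic f (pi *+ 2) ->
  f (2 * pi * (t + z%:~R)) = f (2 * pi * t).
Proof.
move=> pf.
have nat_case (n : nat) u : f (2 * pi * (u + n%:R)) = f (2 * pi * u).
  by rewrite mulrDr mulr_natr mulr_natl periodicn.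
case: z => n; first exact: nat_case.
by rewrite NegzE rmorphN/= -(nat_case n.+1) subrK.
Qed.

Lemma torus_continuous_cosf a : torus_continuous (@cosf R d a).
Proof.
split=> [x|x m]; last first.
  by rewrite /cosf dotDr dot_int periodic_2pi_int//; exact: cosD2pi.
rewrite /cosf; apply: continuous_comp; last exact: continuous_cos.
exact: (cvgM (cvg_cst _) (@dot_continuous a x)).
Qed.

Lemma torus_continuous_sinf a : torus_continuous (@sinf R d a).
Proof.
split=> [x|x m]; last first.
  by rewrite /sinf dotDr dot_int periodic_2pi_int//; exact: sinD2pi.
rewrite /sinf; apply: continuous_comp; last exact: continuous_sin.
exact: (cvgM (cvg_cst _) (@dot_continuous a x)).
Qed.

Lemma cosfDr a (x y : rV) :
  cosf a (x + y) = cosf a x * cosf a y - sinf a x * sinf a y.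
Proof. by rewrite /cosf dotDr mulrDr cosD. Qed.
Lemma sinfDr a (x y : rV) :
  sinf a (x + y) = sinf a x * cosf a y + cosf a x * sinf a y.
Proof. by rewrite /sinf dotDr mulrDr sinD. Qed.
Lemma cosfDl a b (x : rV) :
  cosf (a + b) x = cosf a x * cosf b x - sinf a x * sinf b x.
Proof. by rewrite /cosf dotDl mulrDr cosD. Qed.
Lemma sinfDl a b (x : rV) :
  sinf (a + b) x = sinf a x * cosf b x + cosf a x * sinf b x.
Proof. by rewrite /sinf dotDl mulrDr sinD. Qed.
Lemma cosfNr a (x : rV) : cosf a (- x) = cosf a x.
Proof. by rewrite /cosf dotNr mulrN cosN. Qed.
Lemma sinfNr a (x : rV) : sinf a (- x) = - sinf a x.
Proof. by rewrite /sinf dotNr mulrN sinN. Qed.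
Lemma cosfNl a (x : rV) : cosf (- a) x = cosf a x.
Proof. by rewrite /cosf dotNl mulrN cosN. Qed.
Lemma sinfNl a (x : rV) : sinf (- a) x = - sinf a x.
Proof. by rewrite /sinf dotNl mulrN sinN. Qed.
Lemma cosf0 (x : rV) : cosf 0 x = 1.
Proof. by rewrite /cosf dot0l mulr0 cos0. Qed.
Lemma sinf0 (x : rV) : sinf 0 x = 0.
Proof. by rewrite /sinf dot0l mulr0 sin0. Qed.

(** Some coordinate a_j is nonzero; take 1 / (2 a_j) along that coordinate. *)
Lemma exists_half_period (a : freq) : a != 0 ->
  exists h : rV, 2 * pi * dot a h = pi.
Proof.
move=> a0; have [j aj0] : exists j, a 0 j != 0.
  apply/existsP; apply: contraNT a0; rewrite negb_exists => /forallP aj.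
  by apply/eqP/rowP => j; rewrite mxE; apply/eqP; have := aj j; rewrite negbK.
exists (\row_i (if i == j then (2 * (a 0 j)%:~R)^-1 else 0)).
rewrite /dot (bigD1 j)//= big1 ?addr0 => [|i ij]; last first.
  by rewrite mxE (negbTE ij) mulr0.
have aj : (a 0 j)%:~R != 0 :> R by rewrite intr_eq0.
by rewrite mxE eqxx; field.
Qed.

Lemma torus_int_antiperiodic f h : torus_continuous f ->
  (forall x, f (x + h) = - f x) -> torus_int f = 0.
Proof.
move=> cf fh; have : torus_int f = - torus_int f.
  rewrite -[LHS](torus_int_translate h)// -mulN1r -torus_intZ//.
  by congr torus_int; apply/funext => x; rewrite fh mulN1r.
by move=> ?; lra.
Qed.

(** Translation by half a period multiplies a character of nonzero frequency
    by - 1, whereas it preserves the integral. *)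
Lemma torus_int_cosf a : torus_int (@cosf R d a) = (a == 0)%:R.
Proof.
have [->|a0] := eqVneq a 0.
  rewrite (_ : cosf 0 = fun=> 1) ?torus_int_cst//.
  by apply/funext => x; rewrite cosf0.
have [h ah] := exists_half_period a0.
apply: (@torus_int_antiperiodic _ h); first exact: torus_continuous_cosf.
by move=> x; rewrite /cosf dotDr mulrDr ah cosDpi.
Qed.

Lemma torus_int_sinf a : torus_int (@sinf R d a) = 0.
Proof.
have [->|a0] := eqVneq a 0.
  rewrite (_ : sinf 0 = fun=> 0) ?torus_int_cst//.
  by apply/funext => x; rewrite sinf0.
have [h ah] := exists_half_period a0.
apply: (@torus_int_antiperiodic _ h); first exact: torus_continuous_sinf.
by move=> x; rewrite /sinf dotDr mulrDr ah sinDpi.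
Qed.

(** The torus has finite measure, so a bounded measurable function of two
    points is integrable and both iterated integrals are available. *)
Lemma torus_int2_fubini (f : rV -> rV -> R) :
  measurable_fun setT (fun p : tuples * tuples => f (row_of p.1) (row_of p.2)) ->
  (exists M, forall x y, `|f x y| <= M) ->
  torus_int2 f = torus_int (fun x => torus_int (f x)) /\
  torus_int2 f = torus_int (fun y => torus_int (f^~ y)).
Proof.
move=> mf [M fM].
pose P := (torus R d \x torus R d)%E.
have intf : P.-integrable setT (EFin \o (fun p => f (row_of p.1) (row_of p.2))).
  apply: measurable_bounded_integrable => //.
    by rewrite [X in (X < _)%E](@probability_setT _ _ R P) ltry.
  exists M; split; first exact: num_real.
  by move=> N MN t _ /=; exact: le_trans (ltW MN).
have slice (g : tuples -> R) : measurable_fun setT g -> (forall t, `|g t| <= M) ->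
    (\int[torus R d]_t (g t)%:E)%E = (fine (\int[torus R d]_t (g t)%:E)%E)%:E.
  move=> mg gM; rewrite fineK//; apply: integrable_fin_num => //.
  apply: measurable_bounded_integrable => //.
    by rewrite [X in (X < _)%E](@probability_setT _ _ R (torus R d)) ltry.
  exists M; split; first exact: num_real.
  by move=> N MN t _ /=; exact: le_trans (ltW MN).
split; rewrite /torus_int2 /torus_int /Rintegral; congr fine.
  rewrite -[LHS](integral12_prod_meas1 intf); apply: eq_integral => t _.
  by apply: slice => //; exact: measurableT_comp mf (measurable_pair1 t).
rewrite -[LHS](integral21_prod_meas1 intf); apply: eq_integral => t _.
apply: (slice (fun s => f (row_of s) (row_of t))) => //.
exact: measurableT_comp mf (measurable_pair2 t).
Qed.

Lemma measurable_sub_tuples (q : rV -> R) : continuous q ->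
  measurable_fun setT (fun p : tuples * tuples => q (row_of p.1 - row_of p.2)).
Proof.
move=> cq.
pose sub (p : tuples * tuples) : tuples := [tuple tnth p.1 i - tnth p.2 i | i < d].
rewrite (_ : (fun p => _) = (fun t => q (row_of t)) \o sub).
  apply: (measurableT_comp (continuous_measurable_on_torus cq)).
  apply: measurable_tuple_map => i; apply: measurable_funB.
    exact: measurableT_comp (measurable_tnth i) measurable_fst.
  exact: measurableT_comp (measurable_tnth i) measurable_snd.
apply/funext => p /=; congr q; rewrite row_of_tuple.
by apply/rowP => i; rewrite !mxE.
Qed.
End TorusFunctions.

(** * Fourier coefficients of a translation-invariant kernel *)

Section FourierCoefficients.
Context {R : realType} {d : nat}.
Local Notation rV := 'rV[R]_d.
Local Notation freq := 'rV[int]_d.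
Local Notation RM := (measurableTypeR R).
Local Notation tuples := (d.-tuple (measurableTypeR R)).

Section TranslationInvariant.
Variable eta : rV -> R.
Hypothesis ceta : torus_continuous eta.

Definition cos_coef (a : freq) : R := torus_int (fun y => eta y * cosf a y).
Definition sin_coef (a : freq) : R := torus_int (fun y => eta y * sinf a y).

Lemma cos_coefN a : cos_coef (- a) = cos_coef a.
Proof. by congr torus_int; apply/funext => x; rewrite cosfNl. Qed.

Lemma sin_coefN a : sin_coef (- a) = - sin_coef a.
Proof.
rewrite -mulN1r -torus_intZ; last first.
  exact: torus_continuousM (torus_continuous_sinf a).
by congr torus_int; apply/funext => x; rewrite sinfNl mulrN mulN1r.
Qed.

(** Translating x by y replaces the phase a.x + b.y by a.x + (a + b).y.  The function e stands for cos and sin, which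
    give the real and the imaginary part of a Fourier coefficient. *)
Lemma torus_int2_conv (e : R -> R) (a b : freq) :
  continuous e -> periodic e (pi *+ 2) -> (forall t, `|e t| <= 1) ->
  torus_int2 (fun x y => eta (x - y) * e (2 * pi * (dot a x + dot b y))) =
  torus_int (fun y => torus_int (fun x =>
    eta x * e (2 * pi * dot a x + 2 * pi * dot (a + b) y))).
Proof.
move=> ce pe e1.
have cdot c : measurable_on_torus (fun x : rV => 2 * pi * dot c x).
  apply: continuous_measurable_on_torus => x.
  exact: (cvgM (cvg_cst _) (@dot_continuous R d c x)).
have mf : measurable_fun setT (fun p : tuples * tuples =>
    eta (row_of p.1 - row_of p.2) *
    e (2 * pi * (dot a (row_of p.1) + dot b (row_of p.2)))).
  apply: measurable_funM; first exact: measurable_sub_tuples ceta.1.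
  apply: measurableT_comp; first exact: continuous_measurable_fun.
  under eq_fun do rewrite mulrDr.
  apply: measurable_funD.
    exact: measurableT_comp (cdot a) measurable_fst.
  exact: measurableT_comp (cdot b) measurable_snd.
have bf : exists M, forall x y,
    `|eta (x - y) * e (2 * pi * (dot a x + dot b y))| <= M.
  have [M etaM] := continuous_periodic_bounded ceta.1 ceta.2.
  by exists M => x y; rewrite normrM (le_trans _ (etaM (x - y)))// ler_piMr.
rewrite (torus_int2_fubini mf bf).2; congr torus_int; apply/funext => y.
rewrite -[RHS](@torus_int_translate _ _ _ (- y)); last first.
  apply: torus_continuousM ceta _; split=> [x|x m].
    apply: continuous_comp; last exact: ce.
    exact: (cvgD (cvgM (cvg_cst _) (@dot_continuous R d a x)) (cvg_cst _)).
  rewrite -!mulrDr dotDr dot_int -addrA [_%:~R + _]addrC addrA.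
  exact: periodic_2pi_int.
congr torus_int; apply/funext => x.
by rewrite -mulrDr dotDr dotNr dotDl addrA subrK.
Qed.

Lemma torus_int2_conv_cos (a b : freq) :
  torus_int2 (fun x y => eta (x - y) * cos (2 * pi * (dot a x + dot b y))) =
  cos_coef a * (a + b == 0)%:R.
Proof.
rewrite torus_int2_conv; [|exact: continuous_cos|exact: cosD2pi|]; last first.
  by move=> t; rewrite ler_norml cos_geN1 cos_le1.
have cc := torus_continuousM ceta (torus_continuous_cosf a).
have cs := torus_continuousM ceta (torus_continuous_sinf a).
transitivity (torus_int (fun y : rV =>
    cos_coef a * cosf (a + b) y + (- sin_coef a) * sinf (a + b) y)).
  congr torus_int; apply/funext => y.
  transitivity (torus_int (fun x => cosf (a + b) y * (eta x * cosf a x) +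
      - sinf (a + b) y * (eta x * sinf a x))).
    by congr torus_int; apply/funext => x; rewrite cosD /cosf /sinf; ring.
  rewrite torus_intD; [|exact: torus_continuousZ..].
  by rewrite !torus_intZ// -/(cos_coef a) -/(sin_coef a); ring.
rewrite torus_intD; first last.
- exact/torus_continuousZ/torus_continuous_sinf.
- exact/torus_continuousZ/torus_continuous_cosf.
rewrite !torus_intZ; [|exact: torus_continuous_sinf|exact: torus_continuous_cosf].
by rewrite torus_int_cosf torus_int_sinf mulr0 addr0.
Qed.

Lemma torus_int2_conv_sin (a b : freq) :
  torus_int2 (fun x y => eta (x - y) * sin (2 * pi * (dot a x + dot b y))) =
  sin_coef a * (a + b == 0)%:R.
Proof.
rewrite torus_int2_conv; [|exact: continuous_sin|exact: sinD2pi|]; last first.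
  by move=> t; rewrite ler_norml sin_geN1 sin_le1.
have cc := torus_continuousM ceta (torus_continuous_cosf a).
have cs := torus_continuousM ceta (torus_continuous_sinf a).
transitivity (torus_int (fun y : rV =>
    sin_coef a * cosf (a + b) y + cos_coef a * sinf (a + b) y)).
  congr torus_int; apply/funext => y.
  transitivity (torus_int (fun x => cosf (a + b) y * (eta x * sinf a x) +
      sinf (a + b) y * (eta x * cosf a x))).
    by congr torus_int; apply/funext => x; rewrite sinD /cosf /sinf; ring.
  rewrite torus_intD; [|exact: torus_continuousZ..].
  by rewrite !torus_intZ// -/(cos_coef a) -/(sin_coef a); ring.
rewrite torus_intD; first last.
- exact/torus_continuousZ/torus_continuous_sinf.
- exact/torus_continuousZ/torus_continuous_cosf.
rewrite !torus_intZ; [|exact: torus_continuous_sinf|exact: torus_continuous_cosf].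
by rewrite torus_int_cosf torus_int_sinf mulr0 addr0.
Qed.

(** The condition a + b = 0 comes from the character of frequency a + b that is
    left after the integration over x: its integral over y is 1 or 0. *)
Lemma fourier_coef_conv (a b : freq) :
  fourier_coef (fun x y => eta (x - y)) a b =
  if a + b == 0 then Complex (cos_coef a) (- sin_coef a) else 0.
Proof.
rewrite /fourier_coef /torus_int2C.
rewrite (_ : (fun x y => complex.Re _) =
    fun x y => eta (x - y) * cos (2 * pi * (dot a x + dot b y))); last first.
  by apply/funext => x; apply/funext => y; rewrite /= cosN mul0r subr0.
rewrite (_ : (fun x y => complex.Im _) =
    fun x y => eta (x - y) * sin (2 * pi * (dot (- a) x + dot (- b) y))); last first.
  apply/funext => x; apply/funext => y.
  by rewrite /= mul0r addr0 !dotNl -opprD mulrN.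
rewrite torus_int2_conv_cos torus_int2_conv_sin -opprD oppr_eq0 sin_coefN.
by case: eqP => _; rewrite ?mulr1 ?mulr0.
Qed.

(** For q(z) = eta(z) sin(2 pi a.z), which is odd when eta is even, the double
    integral of q(x - y) is the integral of q when x is integrated first, and
    its opposite when y is. *)
Lemma sin_coef_even (a : freq) : (forall z, eta (- z) = eta z) -> sin_coef a = 0.
Proof.
move=> eta_even; pose q x := eta x * sinf a x.
have cq : torus_continuous q := torus_continuousM ceta (torus_continuous_sinf a).
have mq := measurable_sub_tuples cq.1.
have bq : exists M, forall x y, `|q (x - y)| <= M.
  by have [M qM] := continuous_periodic_bounded cq.1 cq.2; exists M.
have [E1 E2] := torus_int2_fubini (f := fun x y => q (x - y)) mq bq.
have L1 : torus_int2 (fun x y => q (x - y)) = sin_coef a.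
  rewrite E2 -[RHS](@torus_int_cst R d); congr torus_int; apply/funext => y.
  exact: torus_int_translate.
have L2 : torus_int2 (fun x y => q (x - y)) = - sin_coef a.
  rewrite E1 -[RHS](@torus_int_cst R d); congr torus_int; apply/funext => x.
  rewrite -mulN1r -torus_intZ// -[RHS](@torus_int_translate _ _ _ (- x)); last first.
    exact: torus_continuousZ.
  congr torus_int; apply/funext => y; rewrite /q mulN1r -mulrN -sinfNr.
  by rewrite -(eta_even (y - x)) opprB.
by apply/eqP; rewrite -eqNr -L2 L1.
Qed.
End TranslationInvariant.
End FourierCoefficients.

(** * Rectangular sums and Fejer averages *)

Section FiniteBoxes.

Lemma finite_rV (T : choiceType) (n : nat) (B : set T) : finite_set B ->
  finite_set [set v : 'rV[T]_n | forall j, B (v ord0 j)].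
Proof.
move=> finB.
pose h (f : {ffun 'I_n -> fset_set B}) : 'rV[T]_n := \row_j val (f j).
apply: (@sub_finite_set _ _ (range h)); last exact/finite_image/finite_finset.
move=> v Bv; have vB j : v ord0 j \in fset_set B by rewrite in_fset_set ?mem_set.
exists [ffun j => [` vB j]%fset] => //.
by apply/rowP => j; rewrite !mxE ffunE.
Qed.

Lemma finite_int_ball (N : nat) : finite_set [set z : int | (`|z| <= N)%N].
Proof.
apply: (@sub_finite_set _ _ ((Posz @` `I_N.+1) `|`
    ((fun k => - Posz k) @` `I_N.+1))).
  move=> [k|k] /= kN; first by left; exists k.
  by right; exists k.+1 => //; rewrite NegzE.
by rewrite finite_setU; split; exact/finite_image/finite_II.
Qed.

Lemma leq_bigmax_row n (r : 'rV[nat]_n) j : (r ord0 j <= \max_i r ord0 i)%N.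
Proof. exact: leq_bigmax. Qed.

Lemma symmetric_rect_freqs d (r1 r2 : 'rV[nat]_d) :
  symmetric_freqs (rect_freqs r1 r2).
Proof.
split; last by move=> [a b] [/= pa pb]; split=> j /=; rewrite mxE abszN.
pose ball (r : 'rV[nat]_d) : set 'rV[int]_d :=
  [set v | forall j, (`|v ord0 j| <= \max_i r ord0 i)%N].
have finball r : finite_set (ball r) := finite_rV _ (finite_int_ball _).
apply: (@sub_finite_set _ _ (ball r1 `*` ball r2)); last exact: finite_setX.
by move=> [a b] [/= pa pb]; split=> j /=; apply: leq_trans (leq_bigmax_row _ j).
Qed.

Lemma finite_nat_box d (r : 'rV[nat]_d) :
  finite_set [set s : 'rV[nat]_d | forall j, (s ord0 j <= r ord0 j)%N].
Proof.
apply: (@sub_finite_set _ _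
  [set s : 'rV[nat]_d | forall j, `I_((\max_i r ord0 i).+1) (s ord0 j)]).
  by move=> s sr j /=; apply: leq_trans (leq_bigmax_row r j).
exact: finite_rV (finite_II _).
Qed.
End FiniteBoxes.

Section Lincombs.
Context {R : realType} {d : nat}.
Variable K : 'rV[R]_d -> 'rV[R]_d -> R.

Lemma real_lincomb_rect_sum (r1 r2 : 'rV[nat]_d) :
  real_lincomb_fourier_sums K (rect_sum K r1 r2).
Proof.
exists 1%N, (fun=> 1), (fun=> rect_freqs r1 r2).
split=> [_|x y]; first exact: symmetric_rect_freqs.
by rewrite big_ord1 rmorph1 mul1r.
Qed.

Lemma real_lincomb_fejer (r1 r2 : 'rV[nat]_d) :
  real_lincomb_fourier_sums K (fejer_average K r1 r2).
Proof.
pose D := [set s : 'rV[nat]_d * 'rV[nat]_d |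
  (forall j, (s.1 ord0 j <= r1 ord0 j)%N) /\
  (forall j, (s.2 ord0 j <= r2 ord0 j)%N)].
have finD : finite_set D.
  exact: finite_setX (finite_nat_box r1) (finite_nat_box r2).
pose q : R := (\prod_(j < d) ((1 + r1 ord0 j)%N%:R * (1 + r2 ord0 j)%N%:R))^-1.
pose t := in_tuple (fset_set D).
exists (size (fset_set D)), (fun=> q),
  (fun i => rect_freqs (tnth t i).1 (tnth t i).2).
split=> [i|x y]; first exact: symmetric_rect_freqs.
rewrite /fejer_average fsbig_finite// -mulr_sumr; congr (_ * _).
  rewrite /q fmorphV rmorph_prod; congr (_^-1); apply: eq_bigr => j _.
  by rewrite rmorphM !rmorph_nat.
by rewrite (big_tnth _ _ (fset_set D)).
Qed.
End Lincombs.

(** * Canonical form of combinations of partial sums *)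

Section CanonicalForm.
Context {R : realType} {d : nat}.
Local Notation rV := 'rV[R]_d.
Local Notation freq := 'rV[int]_d.
Variable eta : rV -> R.
Hypothesis ceta : torus_continuous eta.
Let K x y := eta (x - y).

(** Real part of (C - i S) exp(2 i pi a.(x - y)): what the frequency pair
    (a, - a) contributes to a partial sum, up to an imaginary part odd in a. *)
Definition freq_term (a : freq) (x y : rV) : R :=
  cos_coef eta a * cosf a (x - y) + sin_coef eta a * sinf a (x - y).

Lemma freq_termE a x y : freq_term a x y =
  cos_coef eta a * (cosf a x * cosf a y + sinf a x * sinf a y) +
  sin_coef eta a * (sinf a x * cosf a y - cosf a x * sinf a y).
Proof. by rewrite /freq_term cosfDr sinfDr cosfNr sinfNr; ring. Qed.

Lemma freq_termN a x y : freq_term (- a) x y = freq_term a x y.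
Proof.
by rewrite /freq_term cos_coefN sin_coefN// cosfNl sinfNl mulrNN.
Qed.

Lemma sum_oppr (V : zmodType) (r : seq freq) (f : freq -> V) :
  uniq r -> (forall a, (- a \in r) = (a \in r)) ->
  \sum_(a <- r) f (- a) = \sum_(a <- r) f a.
Proof.
move=> ur rN; rewrite -(big_map -%R xpredT f); apply: perm_big.
apply: uniq_perm => //; first by rewrite map_inj_uniq//; exact: oppr_inj.
by move=> a; rewrite -[a in LHS]opprK mem_map ?rN//; exact: oppr_inj.
Qed.

(** Only the pairs (a, - a) of L matter.  The sum over a equals the sum over
    - a, and the terms of a and - a are conjugate; averaging the two sums
    leaves the real parts. *)
Lemma fourier_sum_conv (L : set (freq * freq)) : symmetric_freqs L ->
  exists r : seq freq, [/\ uniq r, (forall a, (- a \in r) = (a \in r)) &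
    forall x y, fourier_sum K L x y = (\sum_(a <- r) freq_term a x y)%:C%C].
Proof.
move=> [finL LN].
pose A := [set a : freq | L (a, - a)].
have finA : finite_set A.
  apply: (@sub_finite_set _ _ (fst @` L)); last exact: finite_image.
  by move=> a La; exists (a, - a).
exists (fset_set A).
have rA a : (a \in fset_set A) = (a \in A) by rewrite in_fset_set.
have AN a : A a -> A (- a) by exact: LN.
have rN a : (- a \in fset_set A) = (a \in fset_set A).
  rewrite !rA; apply/idP/idP => /set_mem /AN /mem_set //.
  by rewrite opprK.
split => [|//|x y]; first exact: fset_uniq.
pose t (a : freq) := Complex (cos_coef eta a) (- sin_coef eta a) *
  expi (2 * pi * dot a (x - y)).
transitivity (\sum_(a <- fset_set A) t a).
  rewrite -fsbig_finite// /fourier_sum.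
  rewrite -(@fsbig_widen _ _ _ _ ((fun a => (a, - a)) @` A)); first last.
  - move=> [a b] [/= Lab nA]; rewrite /preimage /= fourier_coef_conv//.
    case: eqP => [ab|_]; last by rewrite mul0r.
    exfalso; apply: nA; exists a; last by rewrite -[b](addKr a) ab addr0.
    by rewrite /A /= -[- a]addr0 -ab addKr.
  - by move=> _ [a La <-].
  rewrite fsbig_image; last by move=> a b _ _ [].
  apply: eq_fsbigr => a _; rewrite fourier_coef_conv// subrr eqxx.
  by rewrite /t /= dotNl dotDr dotNr.
have tN a : t a + t (- a) = (2 * freq_term a x y)%:C%C.
  rewrite /t cos_coefN sin_coefN// dotNl mulrN /freq_term /cosf /sinf.
  rewrite /expi cosN sinN; simpc; congr Complex; ring.
have two0 : (2%:R : R[i]) != 0 by rewrite pnatr_eq0.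
apply: (mulfI two0); rewrite mulr_natl mulr2n.
rewrite -{2}(sum_oppr t (fset_uniq _) rN) -big_split/=.
rewrite -(rmorph_nat (real_complex R)) -rmorphM/= mulr_sumr rmorph_sum/=.
by apply: eq_bigr => a _; rewrite tN.
Qed.

(** n(a) adds the weights of the partial sums that contain (a, - a); it is even
    because each frequency set is symmetric.  It is required to vanish off r so
    that the coefficient matrix built from n is finitely supported. *)
Lemma lincomb_canonical F : real_lincomb_fourier_sums K F ->
  exists (r : seq freq) (n : freq -> R),
    [/\ uniq r, (forall a, (- a \in r) = (a \in r)),
        (forall a, n (- a) = n a), (forall a, a \notin r -> n a = 0) &
        forall x y, F x y = (\sum_(a <- r) n a * freq_term a x y)%:C%C].
Proof.
move=> [m [c [L [symL FE]]]].
have /choice[rs rsP] : forall i : 'I_m, exists r : seq freq,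
    [/\ uniq r, (forall a, (- a \in r) = (a \in r)) &
    forall x y, fourier_sum K (L i) x y = (\sum_(a <- r) freq_term a x y)%:C%C].
  by move=> i; exact: fourier_sum_conv.
pose r := undup (flatten [seq rs i | i <- enum 'I_m]).
have rP a : reflect (exists i, a \in rs i) (a \in r).
  rewrite mem_undup; apply: (iffP flattenP) => [[s /mapP[i _ ->] ai]|[i ai]].
    by exists i.
  by exists (rs i) => //; apply/map_f; rewrite mem_enum.
exists r, (fun a => \sum_i c i * (a \in rs i)%:R).
have rsN i a : (- a \in rs i) = (a \in rs i) by have [_ ->] := rsP i.
split; first exact: undup_uniq.
- by move=> a; apply/rP/rP; case=> i ai; exists i; rewrite ?rsN// -rsN.
- by move=> a; apply: eq_bigr => i _; rewrite rsN.
- move=> a ar; rewrite big1// => i _; case: (boolP (a \in rs i)) => [ai|_].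
    by case/rP: ar; exists i.
  by rewrite mulr0.
move=> x y; rewrite FE.
under [in RHS]eq_bigr do rewrite mulr_suml.
rewrite exchange_big/= rmorph_sum; apply: eq_bigr => i _ /=.
have [uri _ ->] := rsP i; rewrite -rmorphM/=; congr (_%:C)%C.
under [in RHS]eq_bigr do rewrite -mulrA.
rewrite -mulr_sumr; congr (_ * _).
rewrite [RHS](eq_bigr (fun a => if a \in rs i then freq_term a x y else 0))
  => [|a _]; last by case: ifP; rewrite ?mul1r ?mul0r.
rewrite -big_mkcond/= -[RHS]big_filter; apply: perm_big.
apply: uniq_perm => //; first by rewrite filter_uniq// undup_uniq.
move=> a; rewrite mem_filter; case: (boolP (a \in rs i)) => //= ai.
by apply/esym/rP; exists i.
Qed.

End CanonicalForm.

(** * Uniqueness of the coefficient matrix *)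

Section Uniqueness.
Context {R : realType} {d : nat}.
Local Notation rV := 'rV[R]_d.
Local Notation freq := 'rV[int]_d.
Local Notation index := (trig_index d).

Lemma torus_continuous_trig (i : index) : torus_continuous (@trig R d i).
Proof.
rewrite /trig; case: (i.2 == 0).
  exact: torus_continuous_sinf.
exact: torus_continuous_cosf.
Qed.

Definition trig_gram (i j : index) : R := torus_int (fun x => trig i x * trig j x).

(** Product-to-sum formulas reduce every product of two basis functions to
    characters of frequency a - b and a + b. *)
Lemma trig_gramE (i j : index) : trig_gram i j =
  if i.2 == j.2 then
    ((i.1 == j.1)%:R + (if i.2 == 0 then -1 else 1) * (i.1 + j.1 == 0)%:R) / 2
  else 0.
Proof.
have cc a := @torus_continuous_cosf R d a.
have cs a := @torus_continuous_sinf R d a.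
have intc a : torus_int (@cosf R d a) = _ := torus_int_cosf a.
have ints a : torus_int (@sinf R d a) = _ := torus_int_sinf a.
have comb (u v : R) f g : torus_continuous f -> torus_continuous g ->
    torus_int (fun x : rV => u * f x + v * g x) =
    u * torus_int f + v * torus_int g.
  by move=> cf cg; rewrite torus_intD ?torus_intZ//; exact: torus_continuousZ.
case: i j => [a i] [b j] /=; rewrite -[a == b]subr_eq0 /trig_gram /trig /=.
have [-> | i0] := eqVneq i 0; have [j0|j0] := eqVneq j 0.
- rewrite -!intc.
  transitivity (torus_int (fun x : rV =>
      2^-1 * cosf (a - b) x + (- 2^-1) * cosf (a + b) x)).
    by congr torus_int; apply/funext => x; rewrite !cosfDl cosfNl sinfNl; field.
  by rewrite comb//; field.
- transitivity (torus_int (fun x : rV =>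
      2^-1 * sinf (a - b) x + 2^-1 * sinf (a + b) x)).
    by congr torus_int; apply/funext => x; rewrite !sinfDl cosfNl sinfNl; field.
  by rewrite comb// !ints !mulr0 addr0.
- rewrite j0 (negbTE i0).
  transitivity (torus_int (fun x : rV =>
      (- 2^-1) * sinf (a - b) x + 2^-1 * sinf (a + b) x)).
    by congr torus_int; apply/funext => x; rewrite !sinfDl cosfNl sinfNl; field.
  by rewrite comb// !ints !mulr0 addr0.
- have -> : i == j by case: i i0 => [[|[|i]]//= ?]; case: j j0 => [[|[|j]]//= ?].
  rewrite -!intc.
  transitivity (torus_int (fun x : rV =>
      2^-1 * cosf (a - b) x + 2^-1 * cosf (a + b) x)).
    by congr torus_int; apply/funext => x; rewrite !cosfDl cosfNl sinfNl; field.
  by rewrite comb//; field.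
Qed.

Variable H : set freq.
Hypothesis repH : representatives H.

Lemma representatives_neq0 a : H a -> a != 0.
Proof. by move=> Ha; apply/eqP => a0; case: repH => + _; rewrite -a0. Qed.

(** Two representatives are never opposite, so the terms of frequency a + b in
    the Gram matrix of their sines and cosines vanish. *)
Lemma representatives_add a b : H a -> H b -> a + b != 0.
Proof.
move=> Ha Hb; apply/eqP => /eqP; rewrite addr_eq0 => /eqP ab.
have [_ /(_ b (representatives_neq0 Hb))[/(_ Hb) + _]] := repH.
by rewrite -ab.
Qed.

Lemma trig_gram_neq (i j : index) : trig_basis H i -> trig_basis H j -> i != j ->
  trig_gram i j = 0.
Proof.
move=> Bi Bj ij; rewrite trig_gramE; case: ifPn => // /eqP ij2.
have ij1 : i.1 != j.1.
  apply: contraNneq ij => ij1.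
  by rewrite (surjective_pairing i) ij1 ij2 -surjective_pairing.
rewrite (negbTE ij1) add0r.
suff /negbTE -> : i.1 + j.1 != 0 by rewrite mulr0 mul0r.
move: ij1; case: Bi Bj => [Hi|->] [Hj|->] /=.
- by rewrite representatives_add.
- by rewrite addr0.
- by rewrite add0r eq_sym.
- by rewrite eqxx.
Qed.

Lemma trig_gram_eq0F (i : index) : trig_basis H i -> trig_gram i i != 0.
Proof.
move=> Bi; rewrite trig_gramE !eqxx; case: Bi => [Hi|-> /=].
  rewrite (negbTE (representatives_add Hi Hi)) mulr0 addr0.
  by rewrite mulf_neq0 ?invr_eq0 ?pnatr_eq0.
by rewrite addr0 eqxx mulr1 -[_ + 1]/(2%:R : R) mulf_neq0 ?invr_eq0 ?pnatr_eq0.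
Qed.

(** Up to normalization, the (i, j) coefficient of f in the tensor product of
    the trigonometric basis with itself. *)
Definition trig_moment (f : rV -> rV -> R) (i j : index) : R :=
  torus_int (fun x => torus_int (fun y => f x y * trig j y) * trig i x).

Lemma trig_moment_sum (s : seq (index * index)) (c : index * index -> R)
    (i j : index) :
  uniq s -> (forall p, p \in s -> trig_basis H p.1 /\ trig_basis H p.2) ->
  (forall p, p \notin s -> c p = 0) -> trig_basis H i -> trig_basis H j ->
  trig_moment (fun x y => \sum_(p <- s) c p * (trig p.1 x * trig p.2 y)) i j =
  c (i, j) * (trig_gram i i * trig_gram j j).
Proof.
move=> us sB c0 Bi Bj; rewrite /trig_moment.
transitivity (torus_int (fun x : rV =>
    \sum_(p <- s) (c p * trig_gram p.2 j) * (trig p.1 x * trig i x))).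
  congr torus_int; apply/funext => x.
  rewrite [X in torus_int X](_ : _ = fun y : rV =>
      \sum_(p <- s) (c p * trig p.1 x) * (trig p.2 y * trig j y)); last first.
    by apply/funext => y; rewrite mulr_suml; apply: eq_bigr => p _; ring.
  rewrite torus_int_sum => [|p]; last first.
    apply: torus_continuousZ; apply: torus_continuousM;
    exact: torus_continuous_trig.
  rewrite mulr_suml; apply: eq_bigr => p _.
  rewrite torus_intZ; last by apply: torus_continuousM; exact: torus_continuous_trig.
  by rewrite -/(trig_gram _ _); ring.
rewrite torus_int_sum => [|p]; last first.
  apply: torus_continuousZ; apply: torus_continuousM;
  exact: torus_continuous_trig.
transitivity (\sum_(p <- s) c p * (trig_gram p.1 i * trig_gram p.2 j)).
  apply: eq_bigr => p _.
  rewrite torus_intZ; last by apply: torus_continuousM; exact: torus_continuous_trig.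
  by rewrite -/(trig_gram _ _); ring.
have zero p : p \in s -> p != (i, j) ->
    c p * (trig_gram p.1 i * trig_gram p.2 j) = 0.
  case: p => a b /sB[/= Ba Bb]; rewrite xpair_eqE negb_and => /orP[ai|bj].
    by rewrite (trig_gram_neq Ba Bi ai) mul0r mulr0.
  by rewrite (trig_gram_neq Bb Bj bj) !mulr0.
have [ijs|ijs] := boolP ((i, j) \in s).
  rewrite (bigD1_seq (i, j))//= big1_seq ?addr0// => p /andP[pij ps].
  exact: zero.
rewrite c0// mul0r big1_seq// => p /andP[_ ps]; apply: zero => //.
by apply: contraNneq ijs => <-.
Qed.

Lemma coefficient_matrix_coef k F i j : coefficient_matrix H k F ->
  trig_basis H i -> trig_basis H j ->
  trig_moment (fun x y => complex.Re (F x y)) i j =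
  k i j * (trig_gram i i * trig_gram j j).
Proof.
move=> [finS kB FE] Bi Bj.
pose S := [set p : index * index | k p.1 p.2 != 0].
have -> : (fun x y => complex.Re (F x y)) = fun x y =>
    \sum_(p <- fset_set S) k p.1 p.2 * (trig p.1 x * trig p.2 y).
  apply/funext => x; apply/funext => y; rewrite FE /=.
  rewrite -fsbig_finite//; apply/esym/fsbig_widen => [p /kB//|p [_ /= nS]].
  rewrite /preimage /=; move/negP: nS; rewrite negbK => /eqP ->.
  exact: mul0r.
apply: (@trig_moment_sum (fset_set S) (fun p => k p.1 p.2)) => //.
- exact: fset_uniq.
- by move=> p; rewrite in_fset_set// => /set_mem /kB.
- move=> p; rewrite in_fset_set// => pS; apply/eqP; apply: contraNT pS => kp.
  exact: mem_set.
Qed.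

Lemma coefficient_matrix_unique (k k' : index -> index -> R) F :
  coefficient_matrix H k F -> coefficient_matrix H k' F -> k = k'.
Proof.
move=> kF k'F; apply/funext => i; apply/funext => j.
have [[Bi Bj]|nB] := pselect (trig_basis H i /\ trig_basis H j).
  apply: (mulIf (_ : trig_gram i i * trig_gram j j != 0)).
    by rewrite mulf_neq0 ?trig_gram_eq0F.
  rewrite -(coefficient_matrix_coef kF Bi Bj).
  exact: coefficient_matrix_coef k'F Bi Bj.
have [_ kB _] := kF; have [_ k'B _] := k'F.
have /eqP -> : k i j == 0 by apply: contra_notT nB => /kB.
by apply/esym/eqP; apply: contra_notT nB => /k'B.
Qed.
End Uniqueness.

(** * The block-diagonal coefficient matrix *)

Section ExplicitMatrix.
Context {R : realType} {d : nat}.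
Local Notation rV := 'rV[R]_d.
Local Notation freq := 'rV[int]_d.
Local Notation index := (trig_index d).
Variables (eta : rV -> R) (H : set freq).
Hypotheses (ceta : torus_continuous eta) (repH : representatives H).
Variables (r : seq freq) (n : freq -> R).
Hypotheses (ur : uniq r) (rN : forall a, (- a \in r) = (a \in r)).
Hypotheses (nN : forall a, n (- a) = n a) (n0 : forall a, a \notin r -> n a = 0).

(** The factor 2 accounts for the two frequencies a and - a that share the
    block of the representative a; frequency 0 is its own opposite and only
    keeps the entry of the constant function. *)
Definition block_matrix (i j : index) : R :=
  if i.1 != j.1 then 0
  else if `[< H i.1 >] then 2 * n i.1 * Delta eta i.1 i.2 j.2
  else if [&& i == (0, 1) & j == (0, 1)] then n 0 * cos_coef eta 0
  else 0.

Lemma block_matrix_basis i j : block_matrix i j != 0 ->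
  [/\ trig_basis H i, trig_basis H j, i.1 \in r & i.1 = j.1].
Proof.
have in_r a x : n a * x != 0 -> a \in r.
  by apply: contraNT => /n0 ->; rewrite mul0r.
rewrite /block_matrix; case: (eqVneq i.1 j.1) => [ij|_] /=; last by rewrite eqxx.
case: asboolP => [Hi|_].
  rewrite -mulrA mulrCA => /in_r ir; split=> //; first by left.
  by left; rewrite -ij.
case: ifP => [/andP[/eqP i0 /eqP j0]|_]; last by rewrite eqxx.
by move=> /in_r ir; split=> //; [right|right|rewrite i0].
Qed.

(** The index set is infinite when d > 0, but the support of the matrix only
    involves the frequencies of r, and only diagonal pairs of them. *)
Lemma sum_block_matrix (x y : rV) :
  \sum_(p \in trig_basis H `*` trig_basis H)
    block_matrix p.1 p.2 * (trig p.1 x * trig p.2 y) =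
  \sum_(a <- r) \sum_(i < 2) \sum_(j < 2)
    block_matrix (a, i) (a, j) * (trig (a, i) x * trig (a, j) y).
Proof.
rewrite (@fsbig_widen _ _ _ _ _ setT)//; last first.
  move=> p [_ /= nB]; rewrite /preimage /=.
  have [->|] := eqVneq (block_matrix p.1 p.2) 0; first by rewrite mul0r.
  by case/block_matrix_basis => ? ? _ _; case: nB.
pose bas : seq index := [seq (a, i) | a <- r, i <- enum 'I_2].
have ubas : uniq bas.
  by apply: allpairs_uniq => //;
    [exact: enum_uniq | move=> [? ?] [? ?] _ _ [-> ->]].
rewrite (@fsbigE _ _ _ _ _ [seq (i, j) | i <- bas, j <- bas])//; first last.
- move=> [[a i] [b j]] _ ns /=.
  have [->|] := eqVneq (block_matrix (a, i) (b, j)) 0; first by rewrite mul0r.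
  case/block_matrix_basis => /= _ _ ar ab; case/negP: ns.
  by apply: allpairs_f; apply: allpairs_f; rewrite -?ab ?mem_enum.
- by apply: allpairs_uniq => // [[? ?] [? ?] _ _ [-> ->]].
rewrite (eq_bigl xpredT) => [|p]; last by rewrite in_setT.
rewrite big_allpairs_dep /= [LHS]big_allpairs_dep /=; apply: eq_big_seq => a ar.
rewrite big_enum /=; apply: eq_bigr => i _.
rewrite big_allpairs_dep /= (bigD1_seq a)//=.
rewrite [X in _ + X]big1 ?addr0 ?big_enum// => b ba.
by rewrite big1// => j _; rewrite /block_matrix /= eq_sym ba mul0r.
Qed.

(** Let g(a) be the contribution of frequency a to the expansion.  Exactly one
    of a and - a is a representative when a is nonzero, so g(a) + g(- a) is
    twice the canonical term; summing over the symmetric list r counts both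
    sides twice. *)
Lemma coefficient_matrix_block F :
  (forall x y, F x y = (\sum_(a <- r) n a * freq_term eta a x y)%:C%C) ->
  coefficient_matrix H block_matrix F.
Proof.
move=> FE; split.
- apply: (@sub_finite_set _ _ (([set` r] `*` setT) `*` ([set` r] `*` setT))).
    move=> [[a i] [b j]] /block_matrix_basis/= [_ _ ar ab].
    by do 2 split=> //=; rewrite -ab.
  by do 2 apply: finite_setX => //; exact: finite_finset.
- by move=> i j /block_matrix_basis[].
move=> x y; rewrite FE sum_block_matrix; congr (_%:C)%C.
pose g a := \sum_(i < 2) \sum_(j < 2)
  block_matrix (a, i) (a, j) * (trig (a, i) x * trig (a, j) y).
have sum2 (h : 'I_2 -> 'I_2 -> R) :
    \sum_(i < 2) \sum_(j < 2) h i j = h 0 0 + h 0 1 + (h 1 0 + h 1 1).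
  have l1 : lift ord0 ord0 = 1 :> 'I_2 by exact: val_inj.
  by rewrite !big_ord_recl !big_ord0 !addr0 l1.
have gH a : H a -> g a = 2 * (n a * freq_term eta a x y).
  move=> Ha; rewrite /g sum2 /block_matrix !eqxx /=.
  by rewrite (asboolT Ha) /trig /Delta !mxE /= freq_termE -/(cos_coef eta a)
    -/(sin_coef eta a); ring.
have gNH a : ~ H a -> a != 0 -> g a = 0.
  move=> Ha a0; rewrite /g big1// => i _; rewrite big1// => j _.
  by rewrite /block_matrix eqxx /= (asboolF Ha) xpair_eqE (negbTE a0) mul0r.
have g0 : g 0 = n 0 * freq_term eta 0 x y.
  rewrite /g sum2 /block_matrix !eqxx /=.
  rewrite (asboolF (repH.1)) /trig /= freq_termE !cosf0 !sinf0 !xpair_eqE /=.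
  by ring.
have gsym a : g a + g (- a) = 2 * (n a * freq_term eta a x y).
  have [->|a0] := eqVneq a 0; first by rewrite oppr0 g0; ring.
  have [_ /(_ a a0) [H1 H2]] := repH.
  have [Ha|Ha] := pselect (H a).
    by rewrite (gH a Ha) (gNH (- a)) ?addr0 ?oppr_eq0//; exact: H1.
  have HNa : H (- a) by apply: contrapT => /H2.
  by rewrite (gNH a Ha a0) add0r (gH _ HNa) nN freq_termN.
have two0 : (2%:R : R) != 0 by rewrite pnatr_eq0.
apply: (mulfI two0); rewrite [RHS]mulr_natl mulr2n.
rewrite -[X in _ = X + _](sum_oppr g ur rN) -big_split/= mulr_sumr.
by apply: eq_bigr => a _; rewrite addrC gsym.
Qed.
End ExplicitMatrix.

Theorem proposition4p6 (R : realType) (d : nat)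
    (K : 'rV[R]_d -> 'rV[R]_d -> R) (eta : 'rV[R]_d -> R)
    (K_periodic1 : forall y, torus_periodic (fun x => K x y))
    (K_periodic2 : forall x, torus_periodic (K x))
    (K_C2 : Ck 2 (fun z : 'rV[R]_d * 'rV[R]_d => K z.1 z.2))
    (eta_periodic : torus_periodic eta)
    (K_translation_invariant : forall x y, K x y = eta (x - y)) :
  [/\ forall r : 'rV[nat]_d, real_lincomb_fourier_sums K (rect_sum K r r),
      forall r : 'rV[nat]_d, real_lincomb_fourier_sums K (fejer_average K r r)
    & forall F : 'rV[R]_d -> 'rV[R]_d -> R[i],
      real_lincomb_fourier_sums K F ->
      same_frequency_terms F /\
      (forall H : set 'rV[int]_d, representatives H ->
       (exists k : trig_index d -> trig_index d -> R,
          coefficient_matrix H k F) /\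
       (forall k : trig_index d -> trig_index d -> R,
          coefficient_matrix H k F ->
          [/\ block_diagonal_coefs k,
              forall alpha, H alpha ->
                exists c : R, freq_block k alpha = c *: Delta eta alpha,
              exists c : R, k (0, 1) (0, 1) = c * torus_int eta
            & (forall x y, K x y = K y x) -> diagonal_coefs k]))].
Proof.
split=> [r|r|F].
- exact: real_lincomb_rect_sum.
- exact: real_lincomb_fejer.
have ceta : torus_continuous eta.
  split=> // x.
  have -> : eta = (fun z : 'rV[R]_d * 'rV[R]_d => K z.1 z.2) \o (fun x => (x, 0)).
    by apply/funext => z /=; rewrite K_translation_invariant subr0.
  apply: continuous_comp; last exact/differentiable_continuous/K_C2.1.
  exact: (cvg_pair (F := nbhs x) (G := nbhs x) (H := nbhs (0 : 'rV[R]_d))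
    cvg_id (cvg_cst _)).
have KE : K = fun x y => eta (x - y).
  by apply/funext => x; apply/funext => y.
rewrite {1}KE => /(lincomb_canonical ceta)[r [n [ur rN nN n0 FE]]].
split.
  exists [set` r], (fun a => n a * cos_coef eta a),
    (fun a => - (n a * sin_coef eta a)), (fun a => n a * sin_coef eta a),
    (fun a => n a * cos_coef eta a).
  split=> [|x y]; first exact: finite_seq.
  rewrite FE; congr (_%:C)%C; rewrite -fsbig_seq//.
  by apply: eq_bigr => a _; rewrite freq_termE; ring.
move=> H repH; have kF := coefficient_matrix_block ceta repH ur rN nN n0 FE.
split=> [|k kF']; first by exists (block_matrix eta H n).
rewrite (coefficient_matrix_unique repH kF' kF) {k kF'}.
split.
- by move=> a b i j ab; rewrite /block_matrix /= ab.
- move=> a Ha; exists (2 * n a); apply/matrixP => i j.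
  by rewrite [LHS]mxE [RHS]mxE /block_matrix /= eqxx (asboolT Ha).
- exists (n 0); rewrite /block_matrix /= (asboolF repH.1) !eqxx /=.
  congr (_ * _); rewrite /cos_coef; congr torus_int.
  by apply/funext => x; rewrite cosf0 mulr1.
move=> Ksym i j ij.
have eta_even z : eta (- z) = eta z.
  by have := Ksym 0 z; rewrite !K_translation_invariant sub0r subr0.
rewrite /block_matrix; case: (eqVneq i.1 j.1) => //= ij1.
have ij2 : i.2 != j.2.
  apply: contraNneq ij => ij2.
  by rewrite (surjective_pairing i) ij1 ij2 -surjective_pairing.
case: asboolP => _.
  rewrite /Delta mxE (negbTE ij2) -/(sin_coef eta _) sin_coef_even//.
  by rewrite oppr0 if_same mulr0.
by case: ifP => // /andP[/eqP i0 /eqP j0]; case/eqP: ij; rewrite i0 j0.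
Qed.
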